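(* Let $(X,Y)$ be a multiplier pair with identity element $e$, and let $\alpha\in X^{\#}$ with $\alpha(e)=1$. Suppose that (1) $\{R_{B}:B\in\mathcal{L}_{0}\cap\mathcal{R}_{0}\}$ is WOT-dense in $\mathcal{R}$; (2) $[\mathcal{L}^{\#}\alpha]^{-\text{weak*}}=X^{\#}$; and (3) $\mathcal{L}$ is $(e\otimes\alpha)$-tracial. Then $\mathcal{L}$ is maximal $(e\otimes\alpha)$-tracial in $B(X)$.
   Context: A multiplier pair is a pair $(X,Y)$ where $X$ is a Banach space, $Y$ is a Hausdorff topological vector space, $X\subset Y$ (as a linear subspace), and there is a bilinear map $\cdot:X\times X\to Y$ such that: (i) $\cdot$ is continuous in each variable; (ii) there is an identity element $e\in X$ with $a\cdot e=e\cdot a=a$ for every $a\in X$; (iii) the sets $\mathcal{L}_{0}=\{a\in X:a\cdot X\subset X\}$ and $\mathcal{R}_{0}=\{b\in X:X\cdot b\subset X\}$ are dense in $X$; (iv) there are dense subsets $E\subset\mathcal{L}_{0}$, $F\subset X$, $G\subset\mathcal{R}_{0}$ such that $(a\cdot b)\cdot c=a\cdot(b\cdot c)$ for all $a\in E$, $b\in F$, $c\in G$. For $a\in\mathcal{L}_{0}$ and $b\in\mathcal{R}_{0}$ define $L_{a}x=a\cdot x$ and $R_{b}x=x\cdot b$ on $X$, and put $\mathcal{L}=\{L_{a}:a\in\mathcal{L}_{0}\}$, $\mathcal{R}=\{R_{b}:b\in\mathcal{R}_{0}\}$. It is a known theorem on multiplier pairs that $L_a,R_b$ are bounded, so $\mathcal{L},\mathcal{R}\subset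 B(X)$, and that the commutants in $B(X)$ satisfy $\mathcal{L}'=\mathcal{R}$ and $\mathcal{R}'=\mathcal{L}$; in particular $\mathcal{L}$ and $\mathcal{R}$ are unital subalgebras of $B(X)$. $X^{\#}$ is the normed dual of $X$; $T^{\#}$ is the Banach-space adjoint of $T\in B(X)$; $[\mathcal{L}^{\#}\alpha]^{-\text{weak*}}$ is the weak*-closure of $\{L_a^{\#}\alpha:a\in\mathcal{L}_0\}$ in $X^{\#}$. WOT is the weak operator topology on $B(X)$ (pointwise convergence in the weak topology of $X$). The functional $e\otimes\alpha$ on $B(X)$ is $(e\otimes\alpha)(T)=\alpha(Te)$. If $\mathcal{B}$ is a unital algebra and $\varphi$ is a linear functional on $\mathcal{B}$ with $\varphi(1)=1$, a subalgebra $\mathcal{A}$ of $\mathcal{B}$ with $1\in\mathcal{A}$ is $\varphi$-tracial if $\varphi(ab)=\varphi(ba)$ for all $a,b\in\mathcal{A}$; it is maximal $\varphi$-tracial in $\mathcal{B}$ if it is $\varphi$-tracial and no strictly larger subalgebra of $\mathcal{B}$ is $\varphi$-tracial. *)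

(* Defs.v *)
From HB Require Import structures.
From mathcomp Require Import all_boot all_order all_algebra.
From mathcomp Require Import all_classical all_reals all_analysis.
From mathcomp Require Import complex.

Set Implicit Arguments.
Unset Strict Implicit.
Unset Printing Implicit Defensive.

Import Order.TTheory GRing.Theory Num.Theory.
Import numFieldNormedType.Exports.

Local Open Scope classical_set_scope.
Local Open Scope ring_scope.

Variant real_or_complex : numFieldType -> Prop :=
  | RealScalars (R : realType) : real_or_complex R
  | ComplexScalars (R : realType) : real_or_complex R[i].

Section Operators.
Variables (K : numFieldType) (X : normedModType K).

Definition bounded_op : set (X -> X) := [set T | linear T /\ continuous T].

Definition dual : set (X -> K^o) := [set f | linear f /\ continuous f].

Definition adjoint (T : X -> X) (f : X -> K^o) : X -> K^o := f \o T.

(* The weak* topology is the topology that the dual inherits from the product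
   topology of the space of all functions from X to K. *)
Definition weak_star_closure (A : set (X -> K^o)) : set (X -> K^o) :=
  dual `&` closure (A : set {ptws X -> K^o}).

Definition wot_eval (T : X -> X) : {ptws (X * dual)%type -> K^o} :=
  fun p => \val p.2 (T p.1).

(* The weak operator topology is the coarsest one for which T |-> f (T x) is
   continuous for every x in X and f in the dual. *)
Definition wot_closure (A : set (X -> X)) : set (X -> X) :=
  bounded_op `&` closure (A : set (initial_topology wot_eval)).

Definition wot_dense_in (A B : set (X -> X)) : Prop :=
  A `<=` B /\ B `<=` wot_closure A.

Definition unital_subalgebra (A : set (X -> X)) : Prop :=
  [/\ A `<=` bounded_op,
      A id,
      forall (k : K) (S T : X -> X),
        A S -> A T -> A (fun x => k *: S x + T x) &
      forall S T : X -> X, A S -> A T -> A (S \o T)].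

Definition tracial (phi : (X -> X) -> K) (A : set (X -> X)) : Prop :=
  unital_subalgebra A /\
  forall S T : X -> X, A S -> A T -> phi (S \o T) = phi (T \o S).

Definition maximal_tracial (phi : (X -> X) -> K) (A : set (X -> X)) : Prop :=
  tracial phi A /\
  ~ exists A' : set (X -> X), tracial phi A' /\ A `<` A'.

(* The elementary tensor of e and f, as a functional on operators. *)
Definition vector_functional (e : X) (f : X -> K^o) : (X -> X) -> K :=
  fun T => f (T e).

End Operators.

Arguments bounded_op {K} X.
Arguments dual {K} X.

Section Multipliers.
Variables (K : numFieldType) (X : normedModType K) (Y : lmodType K).
Variables (incl : X -> Y) (mul : X -> X -> Y).

Definition left_multipliers : set X :=
  [set a | forall x, range incl (mul a x)].

Definition right_multipliers : set X :=
  [set b | forall x, range incl (mul x b)].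

(* [left_op a x] is the product of a and x, seen as an element of X; it is a
   junk value when the product is not in X. *)
Definition left_op (a x : X) : X := xget 0 [set z | incl z = mul a x].

Definition right_op (b x : X) : X := xget 0 [set z | incl z = mul x b].

Lemma left_opE a x : left_multipliers a -> incl (left_op a x) = mul a x.
Proof.
by move=> /(_ x)[z _ zE]; apply: (@xgetPex _ 0 [set z | incl z = mul a x]); exists z.
Qed.

Lemma right_opE b x : right_multipliers b -> incl (right_op b x) = mul x b.
Proof.
by move=> /(_ x)[z _ zE]; apply: (@xgetPex _ 0 [set z | incl z = mul x b]); exists z.
Qed.

End Multipliers.

(* The inclusion of X in Y is represented by an injective linear map, on which
   no continuity is imposed.  Y need not be locally convex. *)
Record multiplier_pair (K : numFieldType) (X : completeNormedModType K)
    (Y : topologicalLmodType K) := MultiplierPair {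
  mp_hausdorff : hausdorff_space Y;
  mp_incl : {linear X -> Y};
  mp_incl_inj : injective mp_incl;
  mp_mul : X -> X -> Y;
  mp_mul_linearr : forall a, linear (mp_mul a);
  mp_mul_linearl : forall b, linear (mp_mul ^~ b);
  mp_mul_continuousr : forall a, continuous (mp_mul a);
  mp_mul_continuousl : forall b, continuous (mp_mul ^~ b);
  mp_one : X;
  mp_mulr1 : forall a, mp_mul a mp_one = mp_incl a;
  mp_mul1r : forall a, mp_mul mp_one a = mp_incl a;
  mp_left_dense : dense (left_multipliers mp_incl mp_mul);
  mp_right_dense : dense (right_multipliers mp_incl mp_mul);
  mp_assoc : exists E F G : set X,
    [/\ E `<=` left_multipliers mp_incl mp_mul /\
          left_multipliers mp_incl mp_mul `<=` closure E,
        dense F,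
        G `<=` right_multipliers mp_incl mp_mul /\
          right_multipliers mp_incl mp_mul `<=` closure G &
        forall a b c, E a -> F b -> G c ->
          mp_mul (left_op mp_incl mp_mul a b) c =
          mp_mul a (right_op mp_incl mp_mul c b)] }.

Section MultiplierAlgebras.
Variables (K : numFieldType) (X : completeNormedModType K).
Variables (Y : topologicalLmodType K) (P : multiplier_pair X Y).

Definition mp_L0 : set X := left_multipliers (mp_incl P) (mp_mul P).
Definition mp_R0 : set X := right_multipliers (mp_incl P) (mp_mul P).

Definition mp_Lop (a : X) : X -> X := left_op (mp_incl P) (mp_mul P) a.
Definition mp_Rop (b : X) : X -> X := right_op (mp_incl P) (mp_mul P) b.

Definition mp_L : set (X -> X) := mp_Lop @` mp_L0.
Definition mp_R : set (X -> X) := mp_Rop @` mp_R0.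

End MultiplierAlgebras.

(* Main.v *)
Require Import Defs.
From HB Require Import structures.
From mathcomp Require Import all_boot all_order all_algebra.
From mathcomp Require Import all_classical all_reals all_analysis.
From mathcomp Require Import complex.
From mathcomp Require Import ring lra.
Import Order.TTheory GRing.Theory Num.Theory.
Import numFieldNormedType.Exports.

(** Write phi for the functional T |-> alpha (T e).  The idea is that an
operator T lying in a tracial algebra A that contains all the left
multiplications L_a must commute with every right multiplication, and that an
operator commuting with every right multiplication is the left multiplication
by T e ([commutant_right]).

Commutation is first obtained with R_B for B both a left and a right
multiplier ([tracial_commutes_core]).  Since the functionals alpha o L_a are
weak* dense, functionals separate points and X has a dense set of left
multipliers y, it is enough to show
  alpha (L_a (T (R_B y))) = alpha (L_a (R_B (T y))).
Write y = L_y e and R_B y = L_y (L_B e).  The left-hand side is then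
phi (L_a T L_y L_B), which by traciality of A equals phi (L_B L_a T L_y), that
is alpha (L_B (L_a (T y))).  Traciality of the left multiplications alone
gives alpha o L_B = alpha o R_B ([alpha_Rop_eq_Lop]), and L_a commutes with
R_B ([Lop_Rop_comm]), so this is the right-hand side.  Each equation
f (T (R x)) = f (R (T x)) is WOT-closed in R, because f o T is again in the
dual; so WOT-density of the R_B yields commutation with all right
multiplications.

The two ingredients from functional analysis are that right and left
multiplications commute, which comes from spreading the associativity that is
assumed on dense sets one variable at a time, and that the dual of a real or
complex normed space separates points, which is the Hahn-Banach theorem. *)

Local Open Scope classical_set_scope.
Local Open Scope ring_scope.

(** * The Hahn-Banach theorem *)

Section HahnBanach.
Context {R : realType} {K : numFieldType} (iota : {rmorphism R -> K}).
Context {V : lmodType K}.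

(** The scalars r act through a ring morphism iota into the base field of V,
so that the real theory covers a complex space (iota the inclusion of the
reals) without changing its module structure. *)
Definition sublinear (q : V -> R) : Prop :=
  (forall x y, q (x + y) <= q x + q y) /\
  (forall r x, 0 <= r -> q (iota r *: x) <= r * q x).

Lemma sublinear0 (q : V -> R) : sublinear q -> q 0 = 0.
Proof.
move=> [qD qZ]; apply/le_anti/andP; split.
  by have := qZ 0 0 (lexx 0); rewrite scaler0 mul0r.
by have := qD 0 0; rewrite addr0; lra.
Qed.

Lemma sublinearZ (q : V -> R) r x :
  sublinear q -> 0 <= r -> q (iota r *: x) = r * q x.
Proof.
move=> sq; rewrite le_eqVlt => /predU1P[<-|r0].
  by rewrite rmorph0 scale0r mul0r sublinear0.
apply/le_anti; rewrite (sq.2 _ _ (ltW r0)) /= -ler_pdivlMl //.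
have := sq.2 r^-1 (iota r *: x).
by rewrite scalerA -rmorphM mulVf ?gt_eqF // rmorph1 scale1r; apply; rewrite invr_ge0 ltW.
Qed.

Lemma sublinear_geN (q : V -> R) x : sublinear q -> - q (- x) <= q x.
Proof.
move=> sq; have := sq.1 x (- x).
by rewrite subrr sublinear0 //; lra.
Qed.

Definition inf_fun {I : Type} (g : I -> V -> R) (x : V) : R :=
  inf (range (g ^~ x)).

Lemma inf_fun_le {I : Type} (g : I -> V -> R) c i x :
  (forall j, c <= g j x) -> inf_fun g x <= g i x.
Proof.
move=> gm; apply: ge_inf; last by exists i.
by exists c => _ [j _ <-].
Qed.

Lemma le_inf_fun {I : Type} (i0 : I) (g : I -> V -> R) c x :
  (forall i, c <= g i x) -> c <= inf_fun g x.
Proof.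
move=> gc; apply: lb_le_inf; first by exists (g i0 x); exists i0.
by move=> _ [j _ <-].
Qed.

(** The two conditions on k say that the family is directed downwards in the
weak sense in which sublinearity survives an infimum.  Both the members of a
chain and the shifts of one functional along a ray have this property. *)
Lemma inf_fun_sublinear {I : Type} (i0 : I) (g : I -> V -> R) (m : V -> R) :
  (forall i x, m x <= g i x) ->
  (forall i j x y, exists k, g k (x + y) <= g i x + g j y) ->
  (forall i r x, 0 <= r -> exists k, g k (iota r *: x) <= r * g i x) ->
  sublinear (inf_fun g).
Proof.
move=> gm gD gZ.
have le_g i x : inf_fun g x <= g i x by apply: (inf_fun_le _ (m x)).
split=> [x y|r x].
  rewrite -lerBlDr; apply: (le_inf_fun i0) => i.
  rewrite lerBlDr -lerBlDl; apply: (le_inf_fun i0) => j.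
  have [k] := gD i j x y; rewrite lerBlDl; exact: le_trans.
rewrite le_eqVlt => /predU1P[<-|r0].
  have [k] := gZ i0 0 x (lexx 0); rewrite !mul0r; exact: le_trans.
rewrite -ler_pdivrMl //; apply: (le_inf_fun i0) => i.
have [k] := gZ i r x (ltW r0); rewrite ler_pdivrMl //; exact: le_trans.
Qed.

(** The functional is x |-> inf over t >= 0 of q (x + t y) - t q y.  The bounds
come from t = 0 and t = 1.  A q below which there is nothing sublinear but q
itself thus satisfies q x + q y <= q (x + y), hence is additive. *)
Lemma sublinear_shift (q : V -> R) (y : V) : sublinear q ->
  exists q', [/\ sublinear q', forall x, q' x <= q x &
    forall x, q' x <= q (x + y) - q y].
Proof.
move=> sq; have [qD qZ] := sq.
pose I := {t : R | 0 <= t}.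
have pI (t : I) : 0 <= val t by case: t.
pose i0 : I := exist _ 0 (lexx 0).
pose i1 : I := exist _ 1 ler01.
pose g (t : I) x := q (x + iota (val t) *: y) - val t * q y.
have gm t x : - q (- x) <= g t x.
  rewrite /g; have := qD (- x) (x + iota (val t) *: y).
  rewrite addKr.
  by rewrite (sublinearZ _ _ _ sq) //; lra.
have sg : sublinear (inf_fun g).
  apply: (inf_fun_sublinear i0 _ (fun x => - q (- x)) gm).
    move=> i j u v.
    exists (exist _ (val i + val j) (addr_ge0 (pI i) (pI j))).
    rewrite /g /= rmorphD scalerDl addrACA mulrDl.
    have := qD (u + iota (val i) *: y) (v + iota (val j) *: y).
    by lra.
  move=> i r x r0; exists (exist _ (r * val i) (mulr_ge0 r0 (pI i))).
  rewrite /g /= rmorphM -scalerA -scalerDr mulrBr mulrA lerD2r.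
  exact: qZ.
have le_g t x : inf_fun g x <= g t x by apply: (inf_fun_le _ (- q (- x))).
exists (inf_fun g); split => // x.
  by apply: le_trans (le_g i0 x) _; rewrite /g /= rmorph0 scale0r addr0 mul0r subr0.
by apply: le_trans (le_g i1 x) _; rewrite /g /= rmorph1 scale1r mul1r.
Qed.

(** Zorn's lemma for the pointwise order reversed; below p, the values at x of
all sublinear functionals are at least - p (- x). *)
Lemma exists_minimal_sublinear (p : V -> R) : sublinear p ->
  exists q, [/\ sublinear q, forall x, q x <= p x &
    forall q', sublinear q' -> (forall x, q' x <= q x) -> q' = q].
Proof.
move=> sp.
pose T := {q : V -> R | `[< sublinear q /\ forall x, q x <= p x >]}.
pose below (s t : T) := `[< forall x, val t x <= val s x >].
have TP (t : T) : sublinear (val t) /\ forall x, val t x <= p x.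
  by case: t => q /= /asboolP.
have [||||t tmin] := @Zorn T below.
- by move=> t; apply/asboolP.
- move=> r s t /asboolP rs /asboolP st; apply/asboolP => x.
  exact: le_trans (st x) (rs x).
- move=> s t /asboolP st /asboolP ts; apply/val_inj/funext => x.
  by apply/le_anti; rewrite st ts.
- move=> A Atot; have [[a0 Aa0]|nA] := pselect (A !=set0); last first.
    have pP : `[< sublinear p /\ forall x, p x <= p x >] by apply/asboolP.
    by exists (exist _ p pP) => s As; case: nA; exists s.
  pose I := {a : T | `[< A a >]}.
  have AI (i : I) : A (val i) by case: i => a /= /asboolP.
  have IA a (Aa : A a) : exists i : I, val i = a.
    by have Pa : `[< A a >] by [apply/asboolP]; exists (exist _ a Pa).
  have [i0 _] := IA _ Aa0.
  pose g (i : I) : V -> R := val (val i).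
  have gm i x : - p (- x) <= g i x.
    apply: le_trans (sublinear_geN _ x (TP (val i)).1).
    by rewrite lerN2; exact: (TP (val i)).2.
  (* A chain is directed downwards, by the smaller of two given members. *)
  have gmin i j : exists k, forall x, g k x <= g i x /\ g k x <= g j x.
    have [/asboolP ij|/asboolP ji] := Atot _ _ (AI i) (AI j).
      by exists j => x; split => //; exact: ij.
    by exists i => x; split => //; exact: ji.
  have sg : sublinear (inf_fun g).
    apply: (inf_fun_sublinear i0 _ (fun x => - p (- x)) gm).
      move=> i j x y; have [k kP] := gmin i j; exists k.
      apply: le_trans ((TP (val k)).1.1 x y) _; apply: lerD.
        exact: (kP x).1.
      exact: (kP y).2.
    by move=> i r x r0; exists i; apply: (TP (val i)).1.2.
  have le_g i x : inf_fun g x <= g i x by apply: (inf_fun_le _ (- p (- x))).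
  have gP : `[< sublinear (inf_fun g) /\ forall x, inf_fun g x <= p x >].
    apply/asboolP; split=> // x.
    exact: le_trans (le_g i0 x) ((TP (val i0)).2 x).
  pose tg : T := exist _ (inf_fun g) gP.
  exists tg => s /IA[i <-]; apply/asboolP => x; exact: le_g.
exists (val t); split; [exact: (TP t).1 | exact: (TP t).2 |].
move=> q' sq' q't.
have q'P : `[< sublinear q' /\ forall x, q' x <= p x >].
  by apply/asboolP; split=> // x; exact: le_trans (q't x) ((TP t).2 x).
pose t' : T := exist _ q' q'P.
suff /(congr1 val) : t' = t by [].
by apply: tmin; apply/asboolP.
Qed.

(** A minimal sublinear functional is linear.  Starting from the shift p1 of p
along x0, instead of p, forces the value at x0: there p1 (- x0) is at most
p 0 - p x0 = - p x0. *)
Lemma hahn_banach (p : V -> R) (x0 : V) : sublinear p ->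
  exists f : V -> R,
    [/\ forall x y, f (x + y) = f x + f y,
        forall r x, f (iota r *: x) = r * f x,
        forall x, f x <= p x &
        f x0 = p x0].
Proof.
move=> sp; have [p1 [sp1 p1p p1x0]] := sublinear_shift _ x0 sp.
have [f [sf fp1 fmin]] := exists_minimal_sublinear _ sp1.
have fD x y : f (x + y) = f x + f y.
  have [f' [sf' f'f f'y]] := sublinear_shift _ y sf.
  have f'E := fmin _ sf' f'f.
  apply/le_anti; rewrite sf.1 /=.
  by have := f'y x; rewrite f'E; lra.
have fN x : f (- x) = - f x.
  by apply/eqP; rewrite -addr_eq0 -fD addNr sublinear0.
have fp x : f x <= p x by exact: le_trans (fp1 x) (p1p x).
exists f; split=> // [r x|].
  have [r0|r0] := leP 0 r; first exact: sublinearZ.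
  have := sublinearZ _ (- r) x sf; rewrite rmorphN scaleNr fN => H.
  by have := H ltac:(lra); lra.
apply/le_anti; rewrite fp /=.
have := le_trans (fp1 (- x0)) (p1x0 _).
by rewrite fN addNr sublinear0 //; lra.
Qed.

End HahnBanach.

(** * Functionals separating points *)

Lemma dual_bounded {K : numFieldType} {X : normedModType K} (f : X -> K^o) (M : K) :
  0 <= M -> linear f -> (forall x, `|f x| <= M * `|x|) -> dual X f.
Proof.
move=> M0 lf fM; split=> //.
pose mf := GRing.isLinear.Build _ _ _ _ _ lf.
pose g : {linear X -> K^o} := HB.pack f mf.
apply: (bounded_linear_continuous (f := g)).
apply/linear_boundedP; near=> r => x.
apply: le_trans (fM x) _; rewrite ler_wpM2r //.
near: r; exact: nbhs_pinfty_ge (ger0_real M0).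
Unshelve. all: by end_near. Qed.

(** In the complex case Hahn-Banach gives a real-linear u dominated by the norm
with u x = |x|, and f y = u y - i u (i y) is its complex-linear companion,
whose real part is u. *)
Lemma dual_separates_points {K : numFieldType} (hK : real_or_complex K)
    {X : normedModType K} (x : X) :
  (forall f, dual X f -> f x = 0) -> x = 0.
Proof.
case: hK X x => R X x fx0.
  have sp : sublinear (K := R) idfun (fun x : X => `|x|).
    split=> [y z|r y r0]; first exact: ler_normD.
    by rewrite normrZ ger0_norm.
  have [f [fD fZ f_le fx]] := hahn_banach _ _ x sp.
  apply/eqP; rewrite -normr_eq0 -fx; apply/eqP/fx0.
  apply: (@dual_bounded _ _ _ 1) => // [r y z|y]; first by rewrite fD fZ.
  rewrite mul1r ler_norml f_le andbT lerNl.
  have -> : - f y = f (- y) by rewrite -[in RHS]scaleN1r (fZ (-1)) mulN1r.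
  by rewrite -[`|y|]normrN.
have normE (y : X) : `|y| = (complex.Re `|y|)%:C%C by rewrite RRe_real // normr_real.
have sp : sublinear (real_complex R) (fun y : X => complex.Re `|y|).
  split=> [y z|r y r0].
    by rewrite /= -lecR rmorphD /= -!normE; exact: ler_normD.
  by rewrite /= -lecR rmorphM /= -!normE normrZ ger0_norm ?ler0c.
have [u [uD uZ u_le ux]] := hahn_banach _ _ x sp.
have uN y : u (- y) = - u y by rewrite -[in LHS]scaleN1r -(rmorphN1 (real_complex R)) uZ mulN1r.
have u_norm y : `|(u y)%:C%C| <= `|y|.
  rewrite normc_def /= expr0n addr0 sqrtr_sqr normE lecR ler_norml u_le andbT.
  by rewrite lerNl -uN -[`|y|]normrN.
pose f (y : X) : R[i]^o := (u y)%:C%C - 'i%C * (u ('i%C *: y))%:C%C.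
have fdual : dual X f.
  apply: (@dual_bounded _ _ _ 2) => // [k y z|y].
    have uC (a b : R) w : u ((a +i* b)%C *: w) = a * u w + b * u ('i%C *: w).
      rewrite -!uZ -uD; congr (u _); rewrite scalerA -scalerDl; congr (_ *: _).
      by rewrite [LHS]complexE /= mulrC.
    case: k => a b; rewrite /f scalerDr !uD scalerA.
    have -> : 'i%C * (a +i* b)%C = ((- b) +i* a)%C :> R[i].
      by apply/eqP; rewrite eq_complex /= !(mul0r, mul1r, add0r, sub0r) !eqxx.
    rewrite (uC a b) (uC (- b) a); apply/eqP; rewrite eq_complex /=.
    by apply/andP; split; apply/eqP; ring.
  rewrite /f mulr_natl mulr2n; apply: le_trans (ler_normB _ _) _.
  rewrite lerD // normrM.
  have i1 : `|'i%C : R[i]| = 1 by rewrite normc_def /= expr0n expr1n add0r sqrtr1.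
  by rewrite i1 mul1r; apply: le_trans (u_norm _) _; rewrite normrZ i1 mul1r.
have /eqP := fx0 _ fdual.
rewrite /f eq_complex /= => /andP[/eqP fxR _].
apply/eqP; rewrite -normr_eq0 normE -ux.
by move: fxR; rewrite !(mul0r, mul1r, mulr0, subr0, oppr0, addr0) => ->.
Qed.

Lemma dual_comp {K : numFieldType} {X : normedModType K} (f : X -> K^o)
    (S : X -> X) : dual X f -> bounded_op X S -> dual X (f \o S).
Proof.
move=> [lf cf] [lS cS]; split=> [k u v|x]; first by rewrite /= lS lf.
by apply: continuous_comp; [exact: cS | exact: cf].
Qed.

Lemma eq_from_dual {K : numFieldType} (hK : real_or_complex K)
    {X : normedModType K} (x y : X) :
  (forall f, dual X f -> f x = f y) -> x = y.
Proof.
move=> fxy; apply/eqP; rewrite -subr_eq0; apply/eqP.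
apply: (dual_separates_points hK) => f df.
by rewrite addrC -scaleN1r df.1 fxy // scaleN1r addNr.
Qed.

(** * Equations passing to closures *)

Lemma dense_closure {T : topologicalType} (A : set T) x : dense A -> closure A x.
Proof.
move=> dA; rewrite /closure /= => B; rewrite nbhsE => -[U [oU Ux] UB].
have [y [Uy Ay]] := dA U (ex_intro _ x Ux) oU.
by exists y; split => //; exact: UB.
Qed.

Lemma eq_on_closure {T U : topologicalType} (f g : T -> U) (A : set T) x :
  hausdorff_space U -> continuous f -> continuous g ->
  (forall a, A a -> f a = g a) -> closure A x -> f x = g x.
Proof.
move=> hU cf cg fg clx; apply: hU => B C fB gC.
have fB' : nbhs x (f @^-1` B) by exact: cf.
have gC' : nbhs x (g @^-1` C) by exact: cg.
have [a [Aa [Ba Ca]]] := clx _ (filterI fB' gC').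
by exists (f a); split=> //; rewrite fg.
Qed.

Lemma eq_on_dense {T U : topologicalType} (f g : T -> U) (A : set T) x :
  hausdorff_space U -> continuous f -> continuous g -> dense A ->
  (forall a, A a -> f a = g a) -> f x = g x.
Proof.
move=> hU cf cg dA fg; exact: (eq_on_closure _ _ A) (dense_closure _ _ dA).
Qed.

Lemma eq_weak_star_closure {K : numFieldType} {X : normedModType K}
    (A : set (X -> K^o)) (f : X -> K^o) (x y : X) :
  (forall g, A g -> g x = g y) -> weak_star_closure A f -> f x = f y.
Proof.
move=> Axy [_ clf].
apply: (@eq_on_closure {ptws X -> K^o} K^o (fun g => g x) (fun g => g y) A f) => //.
- exact: (@proj_continuous X (fun=> K^o) x).
- exact: (@proj_continuous X (fun=> K^o) y).
Qed.

(** Allowing two functionals and two points makes room for both sides of a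
commutation relation T S = S T, tested as (f o T) (S x) = f (S (T x)). *)
Lemma eq_wot_closure {K : numFieldType} {X : normedModType K}
    (A : set (X -> X)) (T : X -> X) (f g : X -> K^o) (x y : X) :
  dual X f -> dual X g -> (forall S, A S -> f (S x) = g (S y)) ->
  wot_closure A T -> f (T x) = g (T y).
Proof.
move=> df dg fg [_ clT].
have cont (h : X -> K^o) w : dual X h ->
    continuous ((fun S => h (S w)) : initial_topology (@wot_eval K X) -> K^o).
  move=> dh; pose i : X * dual X := (w, SigSub (mem_set dh)).
  move=> S.
  apply: (@continuous_comp (initial_topology (@wot_eval K X))
    {ptws (X * dual X)%type -> K^o} K^o (@wot_eval K X) (fun p => p i)).
    exact: initial_continuous.
  exact: (@proj_continuous _ (fun=> K^o) i).
apply: (@eq_on_closure (initial_topology (@wot_eval K X)) K^o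
  (fun S => f (S x)) (fun S => g (S y)) A T) => //.
- exact: cont.
- exact: cont.
Qed.

(** * Multiplier pairs *)

Section MultiplierPairs.
Context {K : numFieldType} {X : completeNormedModType K}.
Context {Y : topologicalLmodType K} (P : multiplier_pair X Y).
Local Notation e := (mp_one P).
Local Notation L0 := (mp_L0 P).
Local Notation R0 := (mp_R0 P).
Local Notation Lop := (mp_Lop P).
Local Notation Rop := (mp_Rop P).
Local Notation incl := (mp_incl P).
Local Notation mul := (mp_mul P).

Lemma incl_Lop a x : L0 a -> incl (Lop a x) = mul a x.
Proof. by move=> L0a; apply: left_opE. Qed.

Lemma incl_Rop b x : R0 b -> incl (Rop b x) = mul x b.
Proof. by move=> R0b; apply: right_opE. Qed.

(** The inclusion is multiplication by the identity element, hence inherits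
continuity from the product. *)
Lemma continuous_incl : continuous incl.
Proof.
have -> : (incl : X -> Y) = mul e by apply/funext => x; rewrite mp_mul1r.
exact: mp_mul_continuousr.
Qed.

Lemma Lop_one a : L0 a -> Lop a e = a.
Proof. by move=> L0a; apply: (mp_incl_inj (m := P)); rewrite incl_Lop // mp_mulr1. Qed.

Lemma Rop_one b : R0 b -> Rop b e = b.
Proof. by move=> R0b; apply: (mp_incl_inj (m := P)); rewrite incl_Rop // mp_mul1r. Qed.

Lemma Rop_eq_Lop a b : L0 a -> R0 b -> Rop b a = Lop a b.
Proof.
by move=> L0a R0b; apply: (mp_incl_inj (m := P)); rewrite incl_Rop // incl_Lop.
Qed.

(** Associativity (a y) c = a (y c) is known for (a, y, c) in E x F x G.  With
a and c fixed, both sides are continuous in y.  Continuity in a is available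
when y is a right multiplier, since then a y = R_y a; likewise continuity in c
when y is a left multiplier, since then y c = L_y c.  So the middle variable is
extended to X, cut down to the right multipliers to extend a, extended to X
again, cut down to the left multipliers to extend c, and extended once more. *)
Lemma Lop_Rop_comm (contL : forall a, L0 a -> continuous (Lop a))
    (contR : forall b, R0 b -> continuous (Rop b)) a b x :
  L0 a -> R0 b -> Lop a (Rop b x) = Rop b (Lop a x).
Proof.
have [E [F [G [[EL LE] dF [GR RG] assocEFG]]]] := mp_assoc P.
have hY := mp_hausdorff P.
have compc (f : X -> X) (g : X -> Y) :
    continuous f -> continuous g -> continuous (fun y => g (f y)).
  by move=> cf cg y; apply: continuous_comp; [exact: cf|exact: cg].
have mulc a' := mp_mul_continuousr (m := P) a'.
have mulcl b' := mp_mul_continuousl (m := P) b'.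
have EXG a' y c : E a' -> G c -> mul (Lop a' y) c = mul a' (Rop c y).
  move=> Ea Gc.
  apply: (eq_on_dense (fun y => mul (Lop a' y) c) (fun y => mul a' (Rop c y)) F) => //.
  - exact: (compc _ (mul ^~ c) (contL _ (EL _ Ea)) (mulcl c)).
  - exact: (compc _ _ (contR _ (GR _ Gc)) (mulc a')).
  - by move=> y' Fy; exact: assocEFG.
have LRG a' y c : L0 a' -> R0 y -> G c -> mul (Lop a' y) c = mul a' (Rop c y).
  move=> La Ry Gc; rewrite -Rop_eq_Lop //.
  apply: (eq_on_closure (fun a => mul (Rop y a) c) (mul ^~ (Rop c y)) E) => //.
  - exact: (compc _ (mul ^~ c) (contR _ Ry) (mulcl c)).
  - exact: mulcl.
  - by move=> a1 Ea; rewrite (Rop_eq_Lop _ _ (EL _ Ea) Ry); exact: EXG.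
  - exact: LE.
have LXG a' y c : L0 a' -> G c -> mul (Lop a' y) c = mul a' (Rop c y).
  move=> La Gc.
  apply: (eq_on_dense (fun y => mul (Lop a' y) c) (fun y => mul a' (Rop c y)) R0) => //.
  - exact: (compc _ (mul ^~ c) (contL _ La) (mulcl c)).
  - exact: (compc _ _ (contR _ (GR _ Gc)) (mulc a')).
  - exact: mp_right_dense.
  - by move=> y' Ry; exact: LRG.
have LLR a' y c : L0 a' -> L0 y -> R0 c -> mul (Lop a' y) c = mul a' (Rop c y).
  move=> La Ly Rc; rewrite Rop_eq_Lop //.
  apply: (eq_on_closure (mul (Lop a' y)) (fun c => mul a' (Lop y c)) G) => //.
  - exact: mulc.
  - exact: (compc _ _ (contL _ Ly) (mulc a')).
  - by move=> c1 Gc; rewrite -(Rop_eq_Lop _ _ Ly (GR _ Gc)); exact: LXG.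
  - exact: RG.
move=> La Rb; apply: (mp_incl_inj (m := P)); rewrite incl_Lop // incl_Rop //.
apply/esym.
apply: (eq_on_dense (fun y => mul (Lop a y) b) (fun y => mul a (Rop b y)) L0) => //.
- exact: (compc _ (mul ^~ b) (contL _ La) (mulcl b)).
- exact: (compc _ _ (contR _ Rb) (mulc a)).
- exact: mp_left_dense.
- by move=> y Ly; exact: LLR.
Qed.

(** On a right multiplier b, T b = T (R_b e) = R_b (T e) is the product of T e
and b; by density the product of T e with any x is T x, which lies in X. *)
Lemma commutant_right (T : X -> X) : bounded_op X T ->
  (forall b x, R0 b -> T (Rop b x) = Rop b (T x)) -> mp_L P T.
Proof.
move=> [_ cT] TR.
have inclT x : incl (T x) = mul (T e) x.
  apply: (eq_on_dense (fun x => incl (T x)) (mul (T e)) R0).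
  - exact: mp_hausdorff P.
  - by move=> y; apply: continuous_comp; [exact: cT|exact: continuous_incl].
  - exact: mp_mul_continuousr.
  - exact: mp_right_dense.
  - by move=> b Rb; rewrite -{1}(Rop_one b) // TR // incl_Rop.
have LTe : L0 (T e) by move=> x; exists (T x).
exists (T e) => //; apply/funext => x.
by apply: (mp_incl_inj (m := P)); rewrite incl_Lop.
Qed.

End MultiplierPairs.

(** * Operators in tracial algebras *)

Section TracialAlgebras.
Context {K : numFieldType} (hK : real_or_complex K).
Context {X : completeNormedModType K} {Y : topologicalLmodType K}.
Context (P : multiplier_pair X Y) (alpha : X -> K^o).
Context (alpha_dual : dual X alpha).
Local Notation e := (mp_one P).
Local Notation L0 := (mp_L0 P).
Local Notation R0 := (mp_R0 P).
Local Notation Lop := (mp_Lop P).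
Local Notation Rop := (mp_Rop P).
Local Notation phi := (vector_functional e alpha).
Context (bdL : forall a, L0 a -> bounded_op X (Lop a)).
Context (bdR : forall b, R0 b -> bounded_op X (Rop b)).

(** By continuity this need only be seen on a left multiplier z, where it is
the trace identity for L_z and L_B evaluated at the identity element. *)
Lemma alpha_Rop_eq_Lop B z : tracial phi (mp_L P) -> L0 B -> R0 B ->
  alpha (Rop B z) = alpha (Lop B z).
Proof.
move=> [_ L_tr] LB RB.
have contA (S : X -> X) : bounded_op X S -> continuous (alpha \o S).
  by move=> bS; have [] := dual_comp _ _ alpha_dual bS.
apply: (eq_on_dense (alpha \o Rop B) (alpha \o Lop B) L0).
- exact: norm_hausdorff.
- exact/contA/bdR.
- exact/contA/bdL.
- exact: mp_left_dense.
move=> a La; have := L_tr (Lop a) (Lop B) (ex_intro2 _ _ a La erefl)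
  (ex_intro2 _ _ B LB erefl).
by rewrite /vector_functional /= !Lop_one // Rop_eq_Lop.
Qed.

(** The trace identity moves L_B from the right of L_a T L_y to its left. *)
Lemma tracial_commutes_core (A : set (X -> X)) (T : X -> X) B x :
  weak_star_closure [set adjoint (Lop a) alpha | a in L0] = dual X ->
  tracial phi (mp_L P) ->
  tracial phi A -> mp_L P `<=` A -> A T -> L0 B -> R0 B ->
  T (Rop B x) = Rop B (T x).
Proof.
move=> dense_alpha trL trA LA AT LB RB.
have [[A_bd _ _ A_comp] A_tr] := trA.
have AL a : L0 a -> A (Lop a) by move=> La; apply: LA; exists a.
apply: (eq_on_dense (T \o Rop B) (Rop B \o T) L0).
- exact: norm_hausdorff.
- by move=> y; apply: continuous_comp; [exact: (bdR _ RB).2 | exact: (A_bd _ AT).2].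
- by move=> y; apply: continuous_comp; [exact: (A_bd _ AT).2 | exact: (bdR _ RB).2].
- exact: mp_left_dense.
move=> y Ly; apply: (eq_from_dual hK) => f; rewrite -dense_alpha.
apply: eq_weak_star_closure => _ [a La <-].
rewrite /adjoint /=.
rewrite (Lop_Rop_comm P (fun a La => (bdL _ La).2) (fun b Rb => (bdR _ Rb).2)) //.
rewrite alpha_Rop_eq_Lop // Rop_eq_Lop //.
have := A_tr (Lop a \o T \o Lop y) (Lop B)
  (A_comp _ _ (A_comp _ _ (AL _ La) AT) (AL _ Ly)) (AL _ LB).
by rewrite /vector_functional /= !Lop_one.
Qed.

End TracialAlgebras.

Theorem theorem3p1 (K : numFieldType) (hK : real_or_complex K)
    (X : completeNormedModType K) (Y : topologicalLmodType K)
    (P : multiplier_pair X Y) (alpha : X -> K^o)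
    (halpha : dual X alpha) (halpha1 : alpha (mp_one P) = 1)
    (h1 : wot_dense_in (mp_Rop P @` (mp_L0 P `&` mp_R0 P)) (mp_R P))
    (h2 : weak_star_closure [set adjoint (mp_Lop P a) alpha | a in mp_L0 P]
          = dual X)
    (h3 : tracial (vector_functional (mp_one P) alpha) (mp_L P)) :
  maximal_tracial (vector_functional (mp_one P) alpha) (mp_L P).
Proof.
have [[L_bd _ _ _] _] := h3.
have bdL a : mp_L0 P a -> bounded_op X (mp_Lop P a).
  by move=> La; apply: L_bd; exists a.
(* Boundedness of R_b is read off the density hypothesis, as a weak operator
   closure consists of bounded operators. *)
have wotR b : mp_R0 P b ->
    wot_closure (mp_Rop P @` (mp_L0 P `&` mp_R0 P)) (mp_Rop P b).
  by move=> Rb; apply: h1.2; exists b.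
have bdR b : mp_R0 P b -> bounded_op X (mp_Rop P b) by move=> /wotR[].
split=> // -[A [trA [LA nAL]]]; apply: nAL => T AT.
have bdT : bounded_op X T by have [[A_bd _ _ _] _] := trA; exact: A_bd.
apply: (commutant_right _ _ bdT) => b x Rb.
apply: (eq_from_dual hK) => f df.
apply: (eq_wot_closure _ _ (f \o T) f x (T x) (dual_comp _ _ df bdT) df _ (wotR _ Rb)).
move=> _ [B [LB RB] <-] /=; congr (f _).
exact: (tracial_commutes_core hK P alpha halpha bdL bdR A).
Qed.
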